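(* Let $F=\frac1n\sum_{i=1}^n f_i:\mathbb{R}^d\to\mathbb{R}$, where $F$ is differentiable and $\mu$-strongly convex ($\mu>0$), and each $f_i:\mathbb{R}^d\to\mathbb{R}$ is differentiable, convex and $L$-smooth. Let $x^*$ be the unique minimizer of $F$. Let $(x_k,(g_k^i)_{i=1}^n)_{k\ge 0}$ be generated by the SRG algorithm with step sizes $\alpha_k>0$ and lower bounds $\varepsilon_k$, and assume that for all $k\in\mathbb{N}$: (i) $\alpha_k/\varepsilon_k$ is constant (does not depend on $k$); (ii) $\varepsilon_k\in(0,\frac{1}{2n}]$; (iii) $\alpha_k\le \frac{n\varepsilon_k}{20L}$. Define, with $a=0.673$, $$T^k:=\frac{\alpha_k}{n\varepsilon_k}\frac{a}{L}\sum_{i=1}^n\|g_k^i-\nabla f_i(x^* )\|_2^2+\|x_k-x^*\|_2^2 .$$ Then for all $k\in\mathbb{N}$, $$\mathbb{E}[T^{k+1}]\le(1-\alpha_k\zeta)\,\mathbb{E}[T^k]+(1+2n\varepsilon_k)\,2\alpha_k^2\,\sigma_*^2,$$ where $\zeta:=\min\{L/n,\mu\}$ and $\sigma_*^2:=\frac{1}{n^2}\left(\sum_{i=1}^n\|\nabla f_i(x^* )\|_2\right)^2$.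
   Context: $\mathbb{N}=\{0,1,2,\dots\}$ and $[n]=\{1,\dots,n\}$. $\mu$-strongly convex: $F(y)\ge F(x)+\langle\nabla F(x),y-x\rangle+\frac{\mu}{2}\|y-x\|_2^2$ for all $x,y$. $L$-smooth ($L>0$): $\|\nabla f_i(y)-\nabla f_i(x)\|_2\le L\|y-x\|_2$ for all $x,y$. Let $\Delta$ be the probability simplex in $\mathbb{R}^n$ and, for $\varepsilon\in(0,1/n]$, $\Delta(\varepsilon)=\{p\in\Delta: p^i\ge\varepsilon\ \forall i\in[n]\}$. SRG algorithm: parameters are deterministic step sizes $\alpha_k>0$ and lower bounds $\varepsilon_k\in(0,1/n]$; the initialization is a deterministic $x_0\in\mathbb{R}^d$ and $g_0^1,\dots,g_0^n\in\mathbb{R}^d$. For $k=0,1,2,\dots$: 1. $p_k\in\arg\min_{p\in\Delta(\varepsilon_k)}\frac{1}{n^2}\sum_{i=1}^n\frac{1}{p^i}\|g_k^i\|_2^2$ (if the minimizer is not unique, any one, chosen as a function of the history $(i_t,b_t)_{t<k}$); 2. sample $i_k\in[n]$ from $p_k$ (conditionally on the history); 3. $x_{k+1}=x_k-\alpha_k\frac{1}{np_k^{i_k}}\nabla f_{i_k}(x_k)$; 4. sample $b_k\sim\mathrm{Bernoulli}(\varepsilon_k/p_k^{i_k})$ (conditionally on the history and $i_k$); 5. $g_{k+1}^i=\nabla f_i(x_k)$ if $i=i_k$ and $b_k=1$; $g_{k+1}^i=g_k^i$ otherwise. *)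

(* Defs.v *)
From HB Require Import structures.
From mathcomp Require Import all_boot all_order all_algebra.
From mathcomp Require Import all_classical all_reals all_analysis.

Set Implicit Arguments.
Unset Strict Implicit.
Unset Printing Implicit Defensive.

Import Order.TTheory GRing.Theory Num.Theory.
Import numFieldNormedType.Exports.

Local Open Scope classical_set_scope.
Local Open Scope ring_scope.

Section Euclidean.
Context {R : realType} {d : nat}.
Implicit Types (u v x : 'rV[R]_d) (f : 'rV[R]_d -> R).

Definition dot u v : R := \sum_(j < d) u 0 j * v 0 j.

(* The library norm `|u| on 'rV[R]_d is the sup norm. *)
Definition norm2 u : R := Num.sqrt (dot u u).

Definition grad f x : 'rV[R]_d := \row_(j < d) 'D_(delta_mx 0 j) f x.

Definition strongly_convex (mu : R) f : Prop :=
  forall x y, f x + dot (grad f x) (y - x) + mu / 2 * norm2 (y - x) ^+ 2 <= f y.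

Definition smooth (L : R) f : Prop :=
  forall x y, norm2 (grad f y - grad f x) <= L * norm2 (y - x).

End Euclidean.

Section SRG.
Context {R : realType} {n d : nat}.

Definition simplex : set ('I_n -> R) :=
  [set p | (forall i, 0 <= p i) /\ \sum_(i < n) p i = 1].

Definition simplex_lb (e : R) : set ('I_n -> R) :=
  [set p | simplex p /\ forall i, e <= p i].

Definition sampling_cost (g : 'I_n -> 'rV[R]_d) (p : 'I_n -> R) : R :=
  1 / n%:R ^+ 2 * \sum_(i < n) 1 / p i * norm2 (g i) ^+ 2.

Definition is_argmin {T : Type} (A : set T) (phi : T -> R) (p : T) : Prop :=
  A p /\ forall q, A q -> phi p <= phi q.

Context {disp : measure_display} {Omega : measurableType disp}.

Definition history (ik : nat -> Omega -> 'I_n) (bk : nat -> Omega -> bool)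
    (k : nat) (w : Omega) : seq ('I_n * bool) :=
  [seq (ik t w, bk t w) | t <- iota 0 k].

(* [p] maps a history of length k to the sampling vector used at step k, so that
   p_k is [p (history ik bk k w)].  Since the history takes finitely many values,
   the conditional laws of i_k and b_k are given on the atoms of the history. *)
Record SRG (P : probability Omega R) (f : 'I_n -> 'rV[R]_d -> R)
    (alpha eps : nat -> R) (x0 : 'rV[R]_d) (g0 : 'I_n -> 'rV[R]_d)
    (p : seq ('I_n * bool) -> 'I_n -> R)
    (ik : nat -> Omega -> 'I_n) (bk : nat -> Omega -> bool)
    (x : nat -> Omega -> 'rV[R]_d) (g : nat -> Omega -> 'I_n -> 'rV[R]_d) :
    Prop := {
  SRG_measurable_i : forall k i, measurable [set w | ik k w = i];
  SRG_measurable_b : forall k, measurable [set w | bk k w];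
  SRG_x0 : forall w, x 0%N w = x0;
  SRG_g0 : forall w i, g 0%N w i = g0 i;
  SRG_p : forall k w, is_argmin (simplex_lb (eps k)) (sampling_cost (g k w))
                        (p (history ik bk k w));
  SRG_i : forall k (h : seq ('I_n * bool)) i, size h = k ->
    P [set w | history ik bk k w = h /\ ik k w = i] =
    (P [set w | history ik bk k w = h] * (p h i)%:E)%E;
  SRG_x : forall k w, x k.+1 w =
    x k w - (alpha k * (1 / (n%:R * p (history ik bk k w) (ik k w))))
              *: grad (f (ik k w)) (x k w);
  SRG_b : forall k (h : seq ('I_n * bool)) i, size h = k ->
    P [set w | [/\ history ik bk k w = h, ik k w = i & bk k w]] =
    (P [set w | history ik bk k w = h /\ ik k w = i] * (eps k / p h i)%:E)%E;
  SRG_g : forall k w i, g k.+1 w i =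
    if (i == ik k w) && bk k w then grad (f i) (x k w) else g k w i }.

End SRG.

(* Main.v *)
Require Import Defs.
From mathcomp Require Import all_boot all_order all_algebra.
From mathcomp Require Import all_classical all_reals all_analysis.
From mathcomp Require Import ring lra.

Import Order.TTheory GRing.Theory Num.Theory.
Import numFieldNormedType.Exports.

Local Open Scope classical_set_scope.
Local Open Scope ring_scope.

(** Conditionally on the history, writing s_i, h_i for the gradients of f_i at
x* and x_k, G = sum |g_i - s_i|^2, H = sum |h_i - s_i|^2 and
V = n^-2 sum |h_i|^2 / p_i, the mean of T^{k+1} is
   c ((1 - eps) G + eps H) + |x - x*|^2 - 2 alpha <grad F x, x - x*>
   + alpha^2 V,
with c = alpha a / (n eps L). Strong convexity of F and co-coercivity of the
gradients give 2 <grad F x, x - x*> >= mu |x - x*|^2 + H / (n L). For V, split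
|h_i|^2 <= 3 |h_i - g_i|^2 + (3/2) |g_i|^2, use p_i >= eps in the first part and
the optimality of p, sum |g_i|^2 / p_i <= (sum |g_i|)^2 / (1 - n eps), in the
second. As the history takes finitely many values, expectations are finite sums
over histories. *)

(** * Euclidean inner product and norm *)

Section Euclidean.
Context {R : realType} {d : nat}.
Implicit Types (u v x y : 'rV[R]_d) (f : 'rV[R]_d -> R) (c : R).

Lemma dotC u v : dot u v = dot v u.
Proof. by apply: eq_bigr => j _; rewrite mulrC. Qed.

Lemma dotDl u v x : dot (u + v) x = dot u x + dot v x.
Proof.
by rewrite /dot -big_split; apply: eq_bigr => j _; rewrite mxE mulrDl.
Qed.

Lemma dotZl c u x : dot (c *: u) x = c * dot u x.
Proof.
by rewrite /dot mulr_sumr; apply: eq_bigr => j _; rewrite mxE mulrA.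
Qed.

Lemma dotNl u x : dot (- u) x = - dot u x.
Proof. by rewrite -scaleN1r dotZl mulN1r. Qed.

Lemma dot0l x : dot 0 x = 0.
Proof. by rewrite -(scale0r 0) dotZl mul0r. Qed.

Lemma dotDr u v x : dot x (u + v) = dot x u + dot x v.
Proof. by rewrite !(dotC x) dotDl. Qed.

Lemma dotZr c u x : dot x (c *: u) = c * dot x u.
Proof. by rewrite !(dotC x) dotZl. Qed.

Lemma dotNr u x : dot x (- u) = - dot x u.
Proof. by rewrite !(dotC x) dotNl. Qed.

Lemma dot_suml (I : finType) (u : I -> 'rV[R]_d) x :
  dot (\sum_i u i) x = \sum_i dot (u i) x.
Proof.
by apply: (big_morph (dot^~ x)) => [v w|]; rewrite ?dotDl ?dot0l.
Qed.

Definition dotE := (dotDl, dotDr, dotNl, dotNr, dotZl, dotZr).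

Lemma dot_ge0 u : 0 <= dot u u.
Proof. by apply: sumr_ge0 => j _; rewrite -expr2 sqr_ge0. Qed.

Lemma dot_eq0 u : (dot u u == 0) = (u == 0).
Proof.
apply/idP/eqP => [|->]; last by rewrite dot0l.
rewrite psumr_eq0 => [/allP u0|j _]; last by rewrite -expr2 sqr_ge0.
apply/rowP => j; apply/eqP; rewrite mxE.
by have := u0 j (mem_index_enum _); rewrite /= mulf_eq0 orbb.
Qed.

Lemma norm2_ge0 u : 0 <= norm2 u.
Proof. exact: sqrtr_ge0. Qed.

Lemma norm2_sqr u : norm2 u ^+ 2 = dot u u.
Proof. by rewrite sqr_sqrtr// dot_ge0. Qed.

(** Cauchy-Schwarz: for [u] nonzero, expand the squared norm of [dot u u *: v - dot u v *: u] and
    divide by [dot u u]. *)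
Lemma dot_le_norm2 u v : dot u v <= norm2 u * norm2 v.
Proof.
have [->|u0] := eqVneq u 0; first by rewrite dot0l mulr_ge0 ?norm2_ge0.
have u_gt0 : 0 < dot u u by rewrite lt_def dot_eq0 u0 dot_ge0.
apply: le_trans (ler_norm _) _.
rewrite -(ler_pXn2r (_ : 0 < 2)%N) ?nnegrE ?mulr_ge0 ?norm2_ge0//.
rewrite real_normK ?num_real// exprMn !norm2_sqr.
have := dot_ge0 (dot u u *: v - dot u v *: u).
rewrite !dotE (dotC v u) => h; rewrite -subr_ge0 -(pmulr_rge0 _ u_gt0).
by apply: le_trans h _; rewrite le_eqVlt; apply/orP; left; apply/eqP; ring.
Qed.

Lemma norm2D u v : norm2 (u + v) <= norm2 u + norm2 v.
Proof.
rewrite -(ler_pXn2r (_ : 0 < 2)%N) ?nnegrE ?addr_ge0 ?norm2_ge0//.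
rewrite sqrrD !norm2_sqr !dotE (dotC v u).
by have := dot_le_norm2 u v; lra.
Qed.

(** Young's inequality: the squared norm of [c *: u - v], divided by [c], is nonnegative. *)
Lemma norm2D_sqr c u v : 0 < c ->
  norm2 (u + v) ^+ 2 <= (1 + c) * norm2 u ^+ 2 + (1 + c^-1) * norm2 v ^+ 2.
Proof.
move=> c_gt0; rewrite !norm2_sqr.
have := dot_ge0 (c *: u - v); rewrite !dotE (dotC v u) => h.
have : 0 <= c^-1 * (c * (c * dot u u) - c * dot u v - (c * dot u v - dot v v)).
  by rewrite mulr_ge0 ?invr_ge0 ?(ltW c_gt0)//; lra.
suff -> : c^-1 * (c * (c * dot u u) - c * dot u v - (c * dot u v - dot v v)) =
  c * dot u u - 2 * dot u v + c^-1 * dot v v by lra.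
by field; rewrite gt_eqF.
Qed.

(** * Gradients of smooth and of convex functions *)

Lemma derive_grad f x v : differentiable f x -> 'D_v f x = dot (grad f x) v.
Proof.
move=> df; rewrite deriveE//.
(* The differential is linear, so the standard basis reduces it to partial derivatives. *)
have -> : v = \sum_(j < d) v 0 j *: (delta_mx 0 j : 'rV[R]_d).
  by rewrite [LHS]row_sum_delta.
rewrite linear_sum dotC dot_suml; apply: eq_bigr => j _.
rewrite linearZ dotZl /= -deriveE// dotC /dot (bigD1 j)//= !mxE !eqxx mulr1.
by rewrite big1 ?addr0// => i ij; rewrite !mxE eqxx (negbTE ij) mulr0.
Qed.

Lemma is_derive_line f x v (t : R) : (forall y, differentiable f y) ->
  is_derive t 1 (fun s : R => f (x + s *: v)) (dot (grad f (x + t *: v)) v).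
Proof.
move=> df; rewrite -derive_grad//.
have hD (h : R) : (h *: (1 : R) + t) *: v = h *: v + t *: v.
  by rewrite scalerDl [_%:A]mulr1.
have E : (fun h : R => h^-1 *:
    (((fun s : R => f (x + s *: v)) \o shift t) (h *: (1 : R))
      - f (x + t *: v))) =
  (fun h : R => h^-1 *:
    ((f \o shift (x + t *: v)) (h *: v) - f (x + t *: v))).
  by apply/funext => h /=; rewrite hD addrCA.
apply: DeriveDef; last by rewrite /derive E.
by have := @diff_derivable _ _ _ f _ v (df (x + t *: v)); rewrite /derivable E.
Qed.

(** Descent lemma, by the mean value theorem instead of an integral: [psi] is [f] along the segment
    minus the linear and quadratic terms. By Cauchy-Schwarz and smoothness its derivative is
    nonpositive at the intermediate point, hence [psi 1 <= psi 0]. *)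
Lemma smooth_upper_bound L f x y : (forall z, differentiable f z) ->
  smooth L f ->
  f y <= f x + dot (grad f x) (y - x) + L / 2 * norm2 (y - x) ^+ 2.
Proof.
move=> df sf; pose v := y - x.
pose D := dot (grad f x) v.
pose N := dot v v.
pose psi (t : R) := f (x + t *: v) - t * D - t ^+ 2 * (L / 2 * N).
have dpsi (t : R) :
    is_derive t 1 psi (dot (grad f (x + t *: v)) v - D - t * (L * N)).
  have ? := @is_derive_line f x v t df.
  by apply: is_derive_eq; rewrite /GRing.scale/=; lra.
have cpsi : {within `[0, 1], continuous psi}.
  apply: derivable_within_continuous => t _.
  exact: (@ex_derive _ _ _ _ _ _ _ (dpsi t)).
have [t /[!in_itv]/= /andP[t0 t1] E] :=
  @MVT R psi _ 0 1 ltr01 (fun t _ => dpsi t) cpsi.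
have le0 : dot (grad f (x + t *: v)) v - D <= t * (L * N).
  have := dot_le_norm2 (grad f (x + t *: v) - grad f x) v.
  rewrite dotDl dotNl -/D => /le_trans; apply.
  apply: le_trans (ler_wpM2r (norm2_ge0 _) (sf _ _)) _.
  rewrite (addrC x) addrK le_eqVlt; apply/orP; left; apply/eqP.
  rewrite /norm2 dotE dotZr (mulrA t) -expr2 sqrtrM ?sqr_ge0// sqrtr_sqr.
  rewrite gtr0_norm//.
  rewrite -/(norm2 v) -mulrA -mulrA -expr2 norm2_sqr -/N; ring.
move: E; rewrite /psi scale1r scale0r addr0 {2}/v addrCA subrr addr0.
rewrite norm2_sqr -/v -/N -/D; lra.
Qed.

(** For [0 < h <= 1], convexity bounds the difference quotient in direction [y - x] by [f y - f x];
    let [h] tend to 0 from the right. *)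
Lemma convex_grad_lower_bound f x y : differentiable f x ->
  convex_function [set: 'rV[R]_d] f ->
  f x + dot (grad f x) (y - x) <= f y.
Proof.
move=> df cf; rewrite -lerBrDl -derive_grad//.
have dv := @diff_derivable _ _ _ f _ (y - x) df.
rewrite /derive cvg_at_rightE//.
apply: limr_le.
  rewrite -(cvg_at_rightE (fun h : R => h^-1 *: ((f \o shift x) _ - f x)))//.
  apply: cvg_trans dv; apply: cvg_app.
  move=> A [e egt0 Ae]; exists e => // t te t_gt0; apply: Ae => //.
  exact/lt0r_neq0.
near=> h.
have h0 : 0 < h by [].
have h1 : h <= 1 by near: h; exact: nbhs_right_le.
have cfh : f (h *: y + (1 - h) *: x) <= h * f y + (1 - h) * f x.
  exact: (cf (Itv01 (ltW h0) h1) y x (in_setT _) (in_setT _)).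
rewrite /=; have -> : h *: (y - x) + x = h *: y + (1 - h) *: x.
  by rewrite scalerBr scalerBl scale1r -addrA [- _ + _]addrC.
rewrite /= [_ *: _]mulrC ler_pdivrMr//; move: cfh; lra.
Unshelve. all: by end_near. Qed.

(* The Bregman divergence of f at x is nonnegative and L-smooth; evaluate it
   after one gradient step of length 1 / L from y. *)
Lemma convex_smooth_lower_bound L f x y : 0 < L ->
  (forall z, differentiable f z) ->
  convex_function [set: 'rV[R]_d] f -> smooth L f ->
  f x + dot (grad f x) (y - x)
    + 1 / (2 * L) * norm2 (grad f y - grad f x) ^+ 2 <= f y.
Proof.
move=> L_gt0 df cf sf; set u := grad f y - grad f x.
have E : dot u u = dot (grad f y) u - dot (grad f x) u by rewrite {1}/u !dotE.
clearbody u.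
have := @convex_grad_lower_bound f x (y - L^-1 *: u) (df x) cf.
have := @smooth_upper_bound L f y (y - L^-1 *: u) df sf.
have -> : y - L^-1 *: u - y = - (L^-1 *: u) by rewrite addrC addKr.
have -> : y - L^-1 *: u - x = y - x - L^-1 *: u by rewrite addrAC.
rewrite !norm2_sqr !dotE.
have -> : L / 2 * - - (L^-1 * (L^-1 * dot u u)) = 1 / (2 * L) * dot u u.
  by field; rewrite gt_eqF.
have -> : dot (grad f x) u = dot (grad f y) u - dot u u by rewrite E; ring.
have -> : 1 / (2 * L) * dot u u = L^-1 * dot u u / 2 by field; rewrite gt_eqF.
lra.
Qed.

End Euclidean.

(** Cauchy-Schwarz against the all-ones vector [e]. *)
Lemma sqr_sum_le {R : realType} n (r : 'I_n -> R) :
  (\sum_i r i) ^+ 2 <= n%:R * \sum_i r i ^+ 2.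
Proof.
pose u : 'rV[R]_n := \row_i r i; pose e : 'rV[R]_n := const_mx 1.
have Eue : dot u e = \sum_i r i by apply: eq_bigr => i _; rewrite !mxE mulr1.
have Euu : dot u u = \sum_i r i ^+ 2 by apply: eq_bigr => i _; rewrite !mxE.
have Eee : dot e e = n%:R.
  rewrite /dot; under eq_bigr do rewrite !mxE mulr1.
  by rewrite sumr_const card_ord.
have Neue : norm2 e ^+ 2 * norm2 u ^+ 2 = n%:R * \sum_i r i ^+ 2.
  by rewrite !norm2_sqr Eee Euu.
rewrite -Neue -exprMn mulrC -Eue -(@real_normK _ (dot u e)) ?num_real//.
rewrite ler_pXn2r ?nnegrE ?mulr_ge0 ?norm2_ge0// ler_norml.
rewrite dot_le_norm2 andbT lerNl -dotNl.
rewrite (le_trans (dot_le_norm2 _ _))//.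
by rewrite /norm2 dotNl dotNr opprK.
Qed.

(** * The averaged objective and its minimizer *)

Section FiniteSum.
Context {R : realType} {n d : nat}.
Variables (f : 'I_n -> 'rV[R]_d -> R) (F : 'rV[R]_d -> R) (mu L : R).
Hypotheses (n_gt0 : (0 < n)%N)
  (FE : forall x, F x = 1 / n%:R * \sum_(i < n) f i x)
  (f_diff : forall i x, differentiable (f i) x)
  (L_gt0 : 0 < L) (f_smooth : forall i, smooth L (f i)).
Implicit Types x xs : 'rV[R]_d.

Let nR_gt0 : 0 < n%:R :> R. Proof. by rewrite ltr0n. Qed.

Lemma grad_mean x : grad F x = n%:R^-1 *: \sum_i grad (f i) x.
Proof.
have -> : F = n%:R^-1 *: \sum_(i < n) f i.
  by apply/funext => z; rewrite FE div1r /GRing.scale/= fct_sumE.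
apply/rowP => j; rewrite !mxE deriveZ; last first.
  by apply: derivable_sum => i; apply: diff_derivable.
rewrite derive_sum; last by move=> i; apply: diff_derivable.
by rewrite summxE; congr (_ * _); apply: eq_bigr => i _; rewrite mxE.
Qed.

(** By the descent lemma, a step [c *: S] with [c = 1 / (n L)] lowers the sum of the [f i] by at
    least [c * dot S S / 2], which minimality of [xs] permits only for [S = 0]. *)
Lemma sum_grad_min xs : (forall x, F xs <= F x) -> \sum_i grad (f i) xs = 0.
Proof.
move=> xs_min; set S := \sum_i _; apply/eqP; rewrite -dot_eq0.
rewrite eq_le dot_ge0 andbT.
pose c := (n%:R * L)^-1.
have c_gt0 : 0 < c by rewrite invr_gt0 mulr_gt0.
have le_sum : \sum_i f i xs <= \sum_i f i (xs - c *: S).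
  by have := xs_min (xs - c *: S); rewrite !FE ler_pM2l// divr_gt0.
have : \sum_i f i (xs - c *: S) <=
    \sum_i (f i xs - c * dot (grad (f i) xs) S + L / 2 * (c * (c * dot S S))).
  apply: ler_sum => i _.
  have := @smooth_upper_bound _ _ L (f i) xs (xs - c *: S) (f_diff i)
    (f_smooth i).
  rewrite (_ : xs - c *: S - xs = - (c *: S)); last by rewrite addrC addKr.
  by rewrite norm2_sqr !dotE opprK.
rewrite !big_split/= sumrN -mulr_sumr -dot_suml -/S sumr_const card_ord => le2.
have E : (L / 2 * (c * (c * dot S S))) *+ n = c * dot S S / 2.
  by rewrite -mulr_natl /c; field; rewrite !gt_eqF.
rewrite -(pmulr_rle0 _ c_gt0); move: le2; rewrite E; lra.
Qed.

(** Add strong convexity of [F], expanded at [x] and evaluated at [xs], to the average of the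
    co-coercive lower bounds of the [f i], expanded at [xs]. The values of [F] cancel, and so do the
    linear terms at [xs], the gradients there summing to zero. *)
Lemma strongly_convex_dot_lower_bound xs x :
  (forall i, convex_function [set: 'rV[R]_d] (f i)) ->
  strongly_convex mu F -> (forall y, F xs <= F y) ->
  mu * norm2 (x - xs) ^+ 2
    + (n%:R * L)^-1 * \sum_i norm2 (grad (f i) x - grad (f i) xs) ^+ 2
  <= 2 * dot (grad F x) (x - xs).
Proof.
move=> f_convex F_sc xs_min.
have := F_sc x xs; rewrite -[xs - x]opprB dotNr norm2_sqr dotNl dotNr opprK.
rewrite -norm2_sqr.
have : \sum_i (f i xs + dot (grad (f i) xs) (x - xs) + 1 / (2 * L) *
    norm2 (grad (f i) x - grad (f i) xs) ^+ 2) <= \sum_i f i x.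
  by apply: ler_sum => i _; exact: convex_smooth_lower_bound.
rewrite !big_split/= -dot_suml sum_grad_min// dot0l addr0 -mulr_sumr.
set H := \sum_i norm2 _ ^+ 2.
rewrite -(ler_pM2l (_ : 0 < 1 / n%:R)) ?divr_gt0// mulrDr -!FE.
have -> : 1 / n%:R * (1 / (2 * L) * H) = (n%:R * L)^-1 * H / 2.
  by field; rewrite !gt_eqF.
lra.
Qed.

End FiniteSum.

(** * One step of the algorithm from a fixed history *)

Section OneStep.
Context {R : realType} {n d : nat}.
Hypothesis n_gt0 : (0 < n)%N.

Let nR_gt0 : 0 < n%:R :> R. Proof. by rewrite ltr0n. Qed.

(* Compare with the point eps + (1 - n * eps) * norm2 (g i) / sum_j norm2 (g j)
   of the restricted simplex. *)
Lemma sampling_cost_argmin (e : R) (g : 'I_n -> 'rV[R]_d) p :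
  0 < e -> n%:R * e <= 1 / 2 ->
  is_argmin (simplex_lb e) (sampling_cost g) p ->
  \sum_i 1 / p i * norm2 (g i) ^+ 2 <=
    (1 + 2 * n%:R * e) * (\sum_i norm2 (g i)) ^+ 2.
Proof.
move=> e_gt0 ne_le [_ p_min]; set S := \sum_i norm2 (g i).
have ne_ge0 : 0 <= n%:R * e by rewrite mulr_ge0// ltW.
have S_ge0 : 0 <= S by apply: sumr_ge0 => i _; exact: norm2_ge0.
(* The comparison point divides by [S]; when [S = 0] all [g i] vanish. *)
have [S0|S_neq0] := eqVneq S 0.
  rewrite S0 expr0n/= mulr0 big1// => i _.
  move/eqP: S0; rewrite psumr_eq0 => [/allP g0|j _]; last exact: norm2_ge0.
  by have /= /eqP-> := g0 i (mem_index_enum _); rewrite expr0n/= mulr0.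
have S_gt0 : 0 < S by rewrite lt_def S_neq0.
pose s := 1 - n%:R * e.
have s_gt0 : 0 < s by rewrite /s; lra.
pose q i := e + s * (norm2 (g i) / S).
have r_ge0 i : 0 <= s * (norm2 (g i) / S).
  by rewrite mulr_ge0 ?divr_ge0 ?norm2_ge0// ltW.
have q_gt0 i : 0 < q i by rewrite /q ltr_wpDr.
have q_simplex : simplex_lb e q.
  split; [split => [i|]|move=> i]; first exact: ltW.
    rewrite big_split/= -mulr_sumr -mulr_suml -/S divff// mulr1.
    by rewrite sumr_const card_ord -mulr_natl /s addrC subrK.
  by rewrite /q lerDl.
have := p_min q q_simplex; rewrite /sampling_cost ler_pM2l; last first.
  by rewrite divr_gt0// exprn_gt0.
move=> /le_trans; apply.
(* Only the second summand of [q i] is used; clearing the denominator also covers [g i = 0]. *)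
have le_q i : 1 / q i * norm2 (g i) ^+ 2 <= s^-1 * S * norm2 (g i).
  rewrite div1r mulrC ler_pdivrMr// /q mulrDr.
  have -> : s^-1 * S * norm2 (g i) * (s * (norm2 (g i) / S)) = norm2 (g i) ^+ 2.
    by field; rewrite S_neq0 gt_eqF.
  by rewrite lerDr !mulr_ge0 ?norm2_ge0// ?invr_ge0 ltW.
apply: le_trans (ler_sum _ (fun i _ => le_q i)) _.
rewrite -mulr_sumr -/S (_ : s^-1 * S * S = s^-1 * S ^+ 2); last first.
  by rewrite -mulrA.
rewrite ler_wpM2r ?sqr_ge0//.
rewrite -[s^-1]mul1r ler_pdivrMr// /s.
(* With [t = n e], the claim [1 <= (1 + 2 t) (1 - t)] amounts to [t (1 - 2 t) >= 0]. *)
have := mulr_ge0 ne_ge0 (_ : 0 <= 1 - 2 * (n%:R * e)); lra.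
Qed.

Variables (f : 'I_n -> 'rV[R]_d -> R) (xs : 'rV[R]_d).

(** The function T with the weight [c] as a parameter, since constancy of [alpha k / eps k] gives
    the same weight at steps k and k+1. *)
Definition lyapunov (c : R) (x : 'rV[R]_d) (g : 'I_n -> 'rV[R]_d) : R :=
  c * \sum_(i < n) norm2 (g i - grad (f i) xs) ^+ 2 + norm2 (x - xs) ^+ 2.

Definition next_x (al : R) (p : 'I_n -> R) x i :=
  x - (al * (1 / (n%:R * p i))) *: grad (f i) x.

Definition next_g x (g : 'I_n -> 'rV[R]_d) i b j :=
  if (j == i) && b then grad (f j) x else g j.

Lemma sum_next_g x g i b :
  \sum_j norm2 (next_g x g i b j - grad (f j) xs) ^+ 2 =
  \sum_j norm2 (g j - grad (f j) xs) ^+ 2 +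
    b%:R * (norm2 (grad (f i) x - grad (f i) xs) ^+ 2
            - norm2 (g i - grad (f i) xs) ^+ 2).
Proof.
rewrite (bigD1 i)//= [in RHS](bigD1 i)//= {1}/next_g eqxx/=.
rewrite (eq_bigr (fun j => norm2 (g j - grad (f j) xs) ^+ 2)); last first.
  by move=> j ji; rewrite /next_g (negbTE ji).
by case: b => /=; ring.
Qed.

(** The probabilities cancel: [p i * (e / p i) = e], so every [g i] is refreshed with the same
    probability; [p i / (n * p i) = 1 / n], so the step is unbiased; its second moment keeps one
    factor [1 / p i]. *)
Lemma mean_lyapunov_next (al c e : R) (p : 'I_n -> R) x g :
  (forall i, 0 < p i) -> \sum_i p i = 1 ->
  \sum_i p i * (e / p i * lyapunov c (next_x al p x i) (next_g x g i true)
    + (1 - e / p i) * lyapunov c (next_x al p x i) (next_g x g i false)) =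
  c * (1 - e) * \sum_i norm2 (g i - grad (f i) xs) ^+ 2
  + c * e * \sum_i norm2 (grad (f i) x - grad (f i) xs) ^+ 2
  + norm2 (x - xs) ^+ 2
  - 2 * al * dot (n%:R^-1 *: \sum_i grad (f i) x) (x - xs)
  + al ^+ 2 / n%:R ^+ 2 * \sum_i 1 / p i * norm2 (grad (f i) x) ^+ 2.
Proof.
move=> p_gt0 p1; set G := \sum_i norm2 (g i - _) ^+ 2.
set H := \sum_i norm2 (grad (f i) x - _) ^+ 2; set z := norm2 (x - xs) ^+ 2.
rewrite (eq_bigr (fun i => p i * (c * G + z)
  + c * e * norm2 (grad (f i) x - grad (f i) xs) ^+ 2
  - c * e * norm2 (g i - grad (f i) xs) ^+ 2
  - 2 * al / n%:R * dot (grad (f i) x) (x - xs)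
  + al ^+ 2 / n%:R ^+ 2 * (1 / p i * norm2 (grad (f i) x) ^+ 2))).
  rewrite !big_split/= !sumrN -!mulr_sumr -mulr_suml p1 -/G -/H -dot_suml dotZl.
  ring.
move=> i _; rewrite /lyapunov !sum_next_g -/G.
have -> : norm2 (next_x al p x i - xs) ^+ 2 = z
  - 2 * (al * (1 / (n%:R * p i))) * dot (grad (f i) x) (x - xs)
  + (al * (1 / (n%:R * p i))) ^+ 2 * norm2 (grad (f i) x) ^+ 2.
  rewrite /z /next_x addrAC; set y := x - xs; clearbody y.
  rewrite !norm2_sqr !dotE (dotC y); ring.
rewrite /=; field; rewrite !gt_eqF//.
Qed.

Lemma sampling_variance_bound (e : R) (p : 'I_n -> R)
    (g h s : 'I_n -> 'rV[R]_d) :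
  0 < e -> n%:R * e <= 1 / 2 ->
  is_argmin (simplex_lb e) (sampling_cost g) p ->
  \sum_i 1 / p i * norm2 (h i) ^+ 2 <=
  6 / e * (\sum_i norm2 (h i - s i) ^+ 2 + \sum_i norm2 (g i - s i) ^+ 2)
  + (1 + 2 * n%:R * e) * (2 * (\sum_i norm2 (s i)) ^+ 2
                          + 6 * n%:R * \sum_i norm2 (g i - s i) ^+ 2).
Proof.
move=> e_gt0 ne_le p_argmin.
have p_ge i : e <= p i by case: p_argmin => -[].
have p_gt0 i : 0 < p i by apply: lt_le_trans (p_ge i).
have ne_ge0 : 0 <= n%:R * e by rewrite mulr_ge0// ltW.
have := @sampling_cost_argmin e g p e_gt0 ne_le p_argmin.
set H := \sum_i norm2 (h i - s i) ^+ 2; set G := \sum_i norm2 (g i - s i) ^+ 2.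
set S := \sum_i norm2 (s i); set C := \sum_i _ => C_le.
have le_i i : 1 / p i * norm2 (h i) ^+ 2 <=
    6 / e * norm2 (h i - s i) ^+ 2 + 6 / e * norm2 (g i - s i) ^+ 2
    + 3 / 2 * (1 / p i * norm2 (g i) ^+ 2).
  (* Parameter 2 gives the weights 3 and 3/2; splitting [h i - g i] at [s i] with parameter 1
     doubles the 3 to 6. *)
  have := @norm2D_sqr R d 2 (h i - g i) (g i) (ltr0Sn _ 1).
  have := @norm2D_sqr R d 1 (h i - s i) (s i - g i) ltr01.
  rewrite subrK addrA subrK => h1 h2.
  have E : norm2 (s i - g i) ^+ 2 = norm2 (g i - s i) ^+ 2.
    by rewrite -[s i - g i]opprB !norm2_sqr dotNl dotNr opprK.
  rewrite E in h1.
  have pV : 1 / p i <= 1 / e by rewrite !div1r lef_pV2 ?posrE.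
  have pV0 : 0 <= 1 / p i by rewrite divr_ge0// ltW.
  set A := norm2 (h i - s i) ^+ 2 in h1 *.
  set B := norm2 (g i - s i) ^+ 2 in h1 *.
  have AB0 : 0 <= A + B by rewrite addr_ge0 ?sqr_ge0.
  have h3 := ler_wpM2r AB0 pV.
  have h4 : norm2 (h i) ^+ 2 <= 6 * (A + B) + 3 / 2 * norm2 (g i) ^+ 2.
    rewrite invr1 in h1; lra.
  have h5 := ler_wpM2l pV0 h4.
  lra.
apply: le_trans (ler_sum _ (fun i _ => le_i i)) _.
rewrite !big_split/= -!mulr_sumr -/H -/G -/C.
have S_ge0 : 0 <= S by apply: sumr_ge0 => i _; exact: norm2_ge0.
set D := \sum_i norm2 (g i - s i).
have D_ge0 : 0 <= D by apply: sumr_ge0 => i _; exact: norm2_ge0.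
have D_le : D ^+ 2 <= n%:R * G by exact: sqr_sum_le.
have g_ge0 : 0 <= \sum_i norm2 (g i).
  by apply: sumr_ge0 => i _; exact: norm2_ge0.
have g_le : \sum_i norm2 (g i) <= S + D.
  rewrite /S /D -big_split/=; apply: ler_sum => i _.
  by have := norm2D (s i) (g i - s i); rewrite [s i + _]addrC subrK.
have gS : (\sum_i norm2 (g i)) ^+ 2 <= 4 / 3 * S ^+ 2 + 4 * (n%:R * G).
  have : (\sum_i norm2 (g i)) ^+ 2 <= (S + D) ^+ 2.
    by rewrite ler_pXn2r// nnegrE// addr_ge0.
  (* The gap between [4/3 S^2 + 4 D^2] and [(S + D)^2] is [3 (S / 3 - D)^2]. The factor 4/3 cancels
     the earlier 3/2, leaving 2 in front of [S ^+ 2]. *)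
  have := sqr_ge0 (S / 3 - D); lra.
have h6 : C <= (1 + 2 * n%:R * e) * (4 / 3 * S ^+ 2 + 4 * (n%:R * G)).
  apply: le_trans C_le _; rewrite ler_wpM2l//; lra.
move: h6; lra.
Qed.

(* With w = al / (n * L), the bounds [al <= n e / (20 L)] and [n e <= 1 / 2]
   make the coefficients of the two sums of squares at most
   w * (673 / 1000 - 1 + 6 / 20) <= 0 and
   w * (- 673 / 1000 + 673 / 20000 + 12 / 20) <= 0. *)
Lemma one_step_lyapunov (F : 'rV[R]_d -> R) (mu L al e c : R)
    (p : 'I_n -> R) x g :
  (forall x, F x = 1 / n%:R * \sum_(i < n) f i x) ->
  strongly_convex mu F ->
  (forall i x, differentiable (f i) x) ->
  (forall i, convex_function [set: 'rV[R]_d] (f i)) ->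
  0 < L -> (forall i, smooth L (f i)) ->
  (forall x, F xs <= F x) ->
  0 < al -> 0 < e <= 1 / (2 * n%:R) -> al <= n%:R * e / (20 * L) ->
  is_argmin (simplex_lb e) (sampling_cost g) p ->
  c = al / (n%:R * e) * (673 / 1000 / L) ->
  \sum_i p i * (e / p i * lyapunov c (next_x al p x i) (next_g x g i true)
    + (1 - e / p i) * lyapunov c (next_x al p x i) (next_g x g i false)) <=
  (1 - al * Num.min (L / n%:R) mu) * lyapunov c x g
  + (1 + 2 * n%:R * e) *
      (2 * al ^+ 2 * (1 / n%:R ^+ 2 * (\sum_i norm2 (grad (f i) xs)) ^+ 2)).
Proof.
move=> FE F_sc f_diff f_convex L_gt0 f_smooth xs_min al_gt0 /andP[e_gt0 e_le].
move=> al_le p_argmin.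
have [a aE] : exists a : R, a = 673 / 1000 by eexists.
have a_ge0 : 0 <= a by rewrite aE; lra.
rewrite -aE => cE.
have [[[_ p1] p_ge] _] := p_argmin.
have p_gt0 i : 0 < p i by apply: lt_le_trans (p_ge i).
have ne_le : n%:R * e <= 1 / 2.
  move: e_le; rewrite ler_pdivlMr ?mulr_gt0//; lra.
have ne_gt0 : 0 < n%:R * e by rewrite mulr_gt0.
rewrite mean_lyapunov_next// -(@grad_mean _ _ _ f F)//.
have := @strongly_convex_dot_lower_bound _ _ _ f F mu L n_gt0 FE f_diff L_gt0
  f_smooth xs x f_convex F_sc xs_min.
have := @sampling_variance_bound e p g (fun i => grad (f i) x)
  (fun i => grad (f i) xs) e_gt0 ne_le p_argmin.
rewrite /lyapunov.
set G := \sum_i norm2 (g i - _) ^+ 2.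
set H := \sum_i norm2 (grad (f i) x - _) ^+ 2; set z := norm2 (x - xs) ^+ 2.
set V := \sum_i 1 / p i * _; set S := \sum_i norm2 _; set D := dot _ _.
have G_ge0 : 0 <= G by apply: sumr_ge0 => i _; exact: sqr_ge0.
have H_ge0 : 0 <= H by apply: sumr_ge0 => i _; exact: sqr_ge0.
have z_ge0 : 0 <= z by exact: sqr_ge0.
clearbody G H z V S D => V_le D_ge.
(* [q] multiplies [V], [r] is its size after [p i >= e], and [w] is the coefficient of [H] gained
   from co-coercivity; all error terms are compared with [w]. *)
pose w := al / (n%:R * L); pose q := al ^+ 2 / n%:R ^+ 2; pose r := q / e.
have w_gt0 : 0 < w by rewrite divr_gt0// mulr_gt0.
have q_gt0 : 0 < q by rewrite divr_gt0// exprn_gt0.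
have ce : c * e = a * w by rewrite cE /w; field; rewrite !gt_eqF.
have ratio_le : al / (n%:R * e) <= 1 / (20 * L).
  rewrite ler_pdivrMr// mulrC mulrA mulr1; exact: al_le.
have r_le : r <= w / 20.
  have -> : r = al / n%:R * (al / (n%:R * e)).
    by rewrite /r /q; field; rewrite !gt_eqF.
  have -> : w / 20 = al / n%:R * (1 / (20 * L)).
    by rewrite /w; field; rewrite !gt_eqF.
  by rewrite ler_wpM2l// divr_ge0// ltW.
have c_ge0 : 0 <= c by rewrite cE mulr_ge0 ?divr_ge0// ltW.
(* The bound [L / n] controls the contraction of [G], the bound [mu] that of [z]. *)
set m := Num.min _ _.
have m_le1 : m <= L / n%:R by rewrite ge_min lexx.
have m_le2 : m <= mu by rewrite ge_min lexx orbT.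
have acm : al * m * c <= a * w / 20.
  have -> : a * w / 20 = al * (L / n%:R) * (1 / (20 * L) * (a / L)).
    by rewrite /w; field; rewrite !gt_eqF.
  apply: (@le_trans _ _ (al * (L / n%:R) * c)).
    by rewrite ler_wpM2r// ler_wpM2l// ltW.
  rewrite ler_wpM2l//; first by rewrite mulr_ge0 ?divr_ge0// ltW.
  by rewrite cE ler_wpM2r// divr_ge0// ltW.
(* With [t = n e <= 1/2] this is [t (1 + 2 t) <= 1]; it turns the last term of the variance bound
   into [6 * r * G]. *)
have qn : q * (n%:R * (1 + 2 * n%:R * e)) <= r.
  rewrite /r ler_pdivlMr// -[q * _ * e]mulrA ger_pMr//.
  have := mulr_ge0 (ltW ne_gt0) (_ : 0 <= 1 / 2 - n%:R * e); lra.
have {V_le}qV : q * V <= 6 * r * (H + G)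
    + (1 + 2 * n%:R * e) * (2 * q * S ^+ 2) + 6 * r * G.
  apply: (le_trans (ler_wpM2l (ltW q_gt0) V_le)).
  have := ler_wpM2r G_ge0 qn; rewrite /r; lra.
have rH := ler_wpM2r H_ge0 r_le.
have rG := ler_wpM2r G_ge0 r_le.
have acmG := ler_wpM2r G_ge0 acm.
have alD : al * (mu * z) + w * H <= 2 * al * D.
  have := ler_wpM2l (ltW al_gt0) D_ge; rewrite /w; lra.
have almz : al * m * z <= al * (mu * z).
  by rewrite -mulrA ler_wpM2l ?(ltW al_gt0)// ler_wpM2r.
have -> : c * (1 - e) = c - a * w by rewrite -ce; ring.
rewrite ce -/q.
have -> : 2 * al ^+ 2 * (1 / n%:R ^+ 2 * S ^+ 2) = 2 * q * S ^+ 2.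
  by rewrite /q; ring.
have wG := mulr_ge0 (ltW w_gt0) G_ge0.
have wH := mulr_ge0 (ltW w_gt0) H_ge0.
clearbody q r w m; rewrite aE in acmG *.
lra.
Qed.

End OneStep.

(** * Finitely valued random variables *)

Lemma factor_through {A B C : Type} (c0 : C) (h : A -> B) (Y : A -> C) :
  (forall w w', h w = h w' -> Y w = Y w') ->
  exists phi : B -> C, forall w, Y w = phi (h w).
Proof.
(* Choose a preimage under [h]; the default [c0] is taken off the image. *)
move=> hY; exists (fun t =>
  if pselect (exists w, h w = t) is left e then Y (projT1 (cid e)) else c0).
move=> w; case: pselect => [e|[]]; last by exists w.
by apply: hY; rewrite (projT2 (cid e)).
Qed.

(** The variable is a finite combination of indicators of the fibres of [h]; integrate termwise. *)
Lemma expectation_fin_comp {R : realType} {disp : measure_display}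
    {Omega : measurableType disp} (P : probability Omega R) (T : finType)
    (h : Omega -> T) (phi : T -> R) :
  (forall t, measurable [set w | h w = t]) ->
  ('E_P[fun w => phi (h w)] =
    (\sum_t phi t * fine (P [set w | h w = t]))%:E)%E.
Proof.
move=> mh; rewrite unlock.
have E w : (phi (h w))%:E =
    (\sum_t (phi t)%:E * (\1_[set w | h w = t] w)%:E)%E.
  rewrite (bigD1 (h w))//= indicE mem_set//= mule1 big1 ?adde0// => t th.
  rewrite indicE memNset ?mule0//= => hw.
  by rewrite hw eqxx in th.
under eq_integral do rewrite E.
rewrite integral_sum//; last first.
  by move=> t; apply: integrableZl => //; exact: integrable_indic.
rewrite -sumEFin; apply: eq_bigr => t _.
rewrite integralZl//; last exact: integrable_indic.
by rewrite integral_indic// setIT EFinM fineK// fin_num_measure.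
Qed.

(** * Histories: measurability, determinism and joint law *)

Section SRGHistory.
Context {R : realType} {n d : nat} {disp : measure_display}
  {Omega : measurableType disp} {P : probability Omega R}
  {f : 'I_n -> 'rV[R]_d -> R} {alpha eps : nat -> R} {x0 : 'rV[R]_d}
  {g0 : 'I_n -> 'rV[R]_d} {p : seq ('I_n * bool) -> 'I_n -> R}
  {ik : nat -> Omega -> 'I_n} {bk : nat -> Omega -> bool}
  {x : nat -> Omega -> 'rV[R]_d} {g : nat -> Omega -> 'I_n -> 'rV[R]_d}.
Hypothesis x_g_SRG : SRG P f alpha eps x0 g0 p ik bk x g.

Lemma history_rcons k w :
  history ik bk k.+1 w = rcons (history ik bk k w) (ik k w, bk k w).
Proof. by rewrite /history -addn1 iotaD map_cat/= cats1. Qed.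

Lemma size_history k w : size (history ik bk k w) == k.
Proof. by rewrite size_map size_iota. Qed.

Lemma measurable_SRG_b k b : measurable [set w | bk k w = b].
Proof.
case: b; first exact: (SRG_measurable_b x_g_SRG).
rewrite (_ : [set w | _] = ~` [set w | bk k w]).
  exact/measurableC/(SRG_measurable_b x_g_SRG).
by apply/seteqP; split => w /= /negP/negP //; case: (bk k w).
Qed.

Lemma measurable_history k h : measurable [set w | history ik bk k w = h].
Proof.
elim: k h => [|k IH] h.
  have [->|h0] := eqVneq h [::].
    by rewrite (_ : [set w | _] = setT)//; apply/seteqP; split.
  rewrite (_ : [set w | _] = set0)//; apply/seteqP; split => w //= h0'.
  by rewrite -h0' eqxx in h0.
case/lastP: h => [|h [i b]].
  rewrite (_ : [set w | _] = set0)//; apply/seteqP; split => [w|w []].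
  by rewrite /mkset history_rcons; case: (history _ _ _ _).
rewrite (_ : [set w | _] = [set w | history ik bk k w = h] `&`
  ([set w | ik k w = i] `&` [set w | bk k w = b])).
  apply: measurableI; first exact: IH.
  apply: measurableI; first exact: (SRG_measurable_i x_g_SRG).
  exact: measurable_SRG_b.
apply/seteqP; split => w; rewrite /mkset history_rcons.
  by move=> /rcons_inj[? ? ?]; split => //; split.
by move=> [/= -> [/= -> ->]].
Qed.

(** All randomness lies in the draws, the updates being deterministic. This lets expectations be
    computed over histories. *)
Lemma SRG_state_history k w w' : history ik bk k w = history ik bk k w' ->
  (x k w, g k w) = (x k w', g k w').
Proof.
elim: k => [_|k IH].
  rewrite !(SRG_x0 x_g_SRG); congr pair; apply/funext => i.
  by rewrite !(SRG_g0 x_g_SRG).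
rewrite !history_rcons => /rcons_inj[hh ii bb].
have [xx gg] := IH hh; congr pair; first by rewrite !(SRG_x x_g_SRG) xx hh ii.
by apply/funext => i; rewrite !(SRG_g x_g_SRG) xx gg ii bb.
Qed.

(** For [b = true] multiply the two conditional laws; for [b = false] subtract from the mass of
    [B]. *)
Lemma SRG_joint_law k h i b : size h = k ->
  fine (P [set w | (history ik bk k w = h /\ ik k w = i) /\ bk k w = b]) =
  fine (P [set w | history ik bk k w = h]) *
    (p h i * (if b then eps k / p h i else 1 - eps k / p h i)).
Proof.
move=> sh.
have mh := measurable_history k h.
set A := [set w | history ik bk k w = h].
set B := [set w | history ik bk k w = h /\ ik k w = i].
have mB : measurable B.
  by apply: measurableI => //; exact: (SRG_measurable_i x_g_SRG).
have PB : fine (P B) = fine (P A) * p h i.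
  by rewrite (SRG_i x_g_SRG)// fineM// fin_num_measure.
have PBt : fine (P (B `&` [set w | bk k w])) = fine (P B) * (eps k / p h i).
  have := SRG_b x_g_SRG i sh; rewrite -/B.
  rewrite (_ : [set w | [/\ _, _ & _]] = B `&` [set w | bk k w]).
    by move=> ->; rewrite fineM// fin_num_measure.
  by apply/seteqP; split => [w [? ? ?]|w [[? ?] ?]].
case: b; first by rewrite [RHS]mulrA -PB -PBt.
rewrite [RHS]mulrA -PB mulrBr mulr1 -PBt.
have -> : [set w | (history ik bk k w = h /\ ik k w = i) /\ bk k w = false] =
    B `\` [set w | bk k w].
  apply/seteqP; split => [w [? bw]|w [? /negP/negbTE bw]] //.
  by split => //=; rewrite bw.
have mb := SRG_measurable_b x_g_SRG k.
rewrite measureD ?fineB ?fin_num_measure//; first exact: measurableI.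
by rewrite ltey_eq fin_num_measure.
Qed.

End SRGHistory.

(** * Averaging the one-step bound over histories *)

Theorem theorem1 (R : realType) (n d : nat) (n_gt0 : (0 < n)%N)
  (f : 'I_n -> 'rV[R]_d -> R) (F : 'rV[R]_d -> R) (mu L : R)
  (FE : forall x, F x = 1 / n%:R * \sum_(i < n) f i x)
  (F_diff : forall x, differentiable F x)
  (mu_gt0 : 0 < mu) (F_strongly_convex : strongly_convex mu F)
  (f_diff : forall i x, differentiable (f i) x)
  (f_convex : forall i, convex_function [set: 'rV[R]_d] (f i))
  (L_gt0 : 0 < L) (f_smooth : forall i, smooth L (f i))
  (xs : 'rV[R]_d) (xs_min : forall x, F xs <= F x)
  (disp : measure_display) (Omega : measurableType disp)
  (P : probability Omega R)
  (alpha eps : nat -> R) (x0 : 'rV[R]_d) (g0 : 'I_n -> 'rV[R]_d)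
  (p : seq ('I_n * bool) -> 'I_n -> R)
  (ik : nat -> Omega -> 'I_n) (bk : nat -> Omega -> bool)
  (x : nat -> Omega -> 'rV[R]_d) (g : nat -> Omega -> 'I_n -> 'rV[R]_d)
  (x_g_SRG : SRG P f alpha eps x0 g0 p ik bk x g)
  (alpha_gt0 : forall k, 0 < alpha k)
  (alpha_eps_cst : forall k l, alpha k / eps k = alpha l / eps l)
  (eps_bound : forall k, 0 < eps k <= 1 / (2 * n%:R))
  (alpha_bound : forall k, alpha k <= n%:R * eps k / (20 * L)) :
  let a : R := 673 / 1000 in
  let T (k : nat) (w : Omega) : R :=
    alpha k / (n%:R * eps k) * (a / L) *
      \sum_(i < n) norm2 (g k w i - grad (f i) xs) ^+ 2
    + norm2 (x k w - xs) ^+ 2 in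
  let zeta := Num.min (L / n%:R) mu in
  let sigma2 := 1 / n%:R ^+ 2 * (\sum_(i < n) norm2 (grad (f i) xs)) ^+ 2 in
  forall k : nat,
    ('E_P[T k.+1] <= (1 - alpha k * zeta)%:E * 'E_P[T k]
       + ((1 + 2 * n%:R * eps k) * (2 * alpha k ^+ 2 * sigma2))%:E)%E.
Proof.
move=> a T zeta sigma2 k.
have nR_gt0 : 0 < n%:R :> R by rewrite ltr0n.
pose c := alpha k / (n%:R * eps k) * (a / L).
have cS : alpha k.+1 / (n%:R * eps k.+1) * (a / L) = c.
  have alphaE l : alpha l / (n%:R * eps l) = alpha l / eps l / n%:R.
    by field; rewrite !gt_eqF//; case/andP: (eps_bound l).
  by rewrite /c !alphaE (alpha_eps_cst k.+1 k).
(* Histories of length k become tuples, which form a finite type. *)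
pose hk w : k.-tuple ('I_n * bool) :=
  Tuple (size_history k w : size (history ik bk k w) == k).
have hkE w (h : k.-tuple ('I_n * bool)) : (hk w = h) = (history ik bk k w = h).
  by apply/propext; split => [<-//|?]; exact/val_inj.
have mhk h : measurable [set w | hk w = h].
  by under eq_set do rewrite hkE; exact: (measurable_history x_g_SRG).
have [phi phiE] := @factor_through _ _ _ (0, fun=> 0) hk
  (fun w => (x k w, g k w)) (fun w w' e =>
    SRG_state_history x_g_SRG k w w' (congr1 val e)).
pose X h := (phi h).1; pose G h := (phi h).2.
have XE w : x k w = X (hk w) by rewrite /X -phiE.
have GE w : g k w = G (hk w) by rewrite /G -phiE.
pose step (u : k.-tuple ('I_n * bool) * 'I_n * bool) : R :=
  let: (h, i, b) := u in
  lyapunov f xs c (next_x f (alpha k) (p h) (X h) i)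
                  (next_g f (X h) (G h) i b).
have T0 : T k = fun w => lyapunov f xs c (X (hk w)) (G (hk w)).
  by apply/funext => w; rewrite -XE -GE.
have T1 : T k.+1 = fun w => step (hk w, ik k w, bk k w).
  apply/funext => w; rewrite /T cS /step /lyapunov /next_x /next_g -XE -GE.
  congr (_ * _ + _); last by rewrite (SRG_x x_g_SRG).
  by apply: eq_bigr => i _; rewrite (SRG_g x_g_SRG).
pose m h := fine (P [set w | hk w = h]).
have m_ge0 h : 0 <= m h by exact: fine_ge0.
have m1 : \sum_h m h = 1.
  have := @expectation_fin_comp _ _ _ P _ hk (fun=> 1) mhk.
  rewrite expectation_cst => -[->].
  by apply: eq_bigr => h _; rewrite mul1r.
have uE u : [set w | (hk w, ik k w, bk k w) = u] =
  [set w | (history ik bk k w = u.1.1 /\ ik k w = u.1.2) /\ bk k w = u.2].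
  case: u => [[h i] b]; apply/seteqP; split => w /=.
    by move=> [<- <- <-].
  by move=> [[hh <-] <-]; congr (_, _, _); rewrite hkE.
rewrite T0 (@expectation_fin_comp _ _ _ P _ hk
  (fun h => lyapunov f xs c (X h) (G h)))//.
rewrite T1 (@expectation_fin_comp _ _ _ P _ (fun w => (hk w, ik k w, bk k w)));
    last first.
  move=> u; rewrite uE; apply: measurableI.
    apply: measurableI; first exact: (measurable_history x_g_SRG).
    exact: (SRG_measurable_i x_g_SRG).
  exact: (measurable_SRG_b x_g_SRG).
rewrite -EFinM -EFinD lee_fin.
set C := (1 + _) * _.
(* The masses sum to one, so the additive term spreads over the histories and both sides are
   compared history by history. *)
rewrite -[C]mulr1 -[X in C * X]m1 !mulr_sumr -big_split/=.
pose Q h i b := step (h, i, b) * (m h *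
  (p h i * (if b then eps k / p h i else 1 - eps k / p h i))).
rewrite (eq_bigr (fun u => Q u.1.1 u.1.2 u.2)); last first.
  move=> [[h i] b] _; congr (_ * _).
  rewrite uE (SRG_joint_law x_g_SRG) ?size_tuple//=.
  by rewrite /m; under [in RHS]eq_set do rewrite hkE.
rewrite -(pair_bigA _ (fun hi b => Q hi.1 hi.2 b)).
rewrite -(pair_bigA _ (fun h i => \sum_b Q h i b)).
apply: ler_sum => h _.
under eq_bigr do rewrite big_bool /Q.
(* Optimality of [p h] is given only at attained histories: null ones contribute zero to both sides,
   and the others are attained by some [w]. *)
have [mh0|mh_neq0] := eqVneq (m h) 0.
  by rewrite -/(m h) mh0 big1/= => [|i _]; rewrite !(mul0r, mulr0, addr0).
have [w hw] : exists w, hk w = h.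
  apply: contrapT => hN; move/eqP: mh_neq0; apply; rewrite /m.
  rewrite (_ : [set w | _] = set0) ?measure0//.
  by apply/seteqP; split => w //= hw; apply: hN; exists w.
rewrite (eq_bigr (fun i => m h * (p h i * (eps k / p h i * step (h, i, true)
  + (1 - eps k / p h i) * step (h, i, false))))); last by move=> i _ /=; ring.
rewrite -mulr_sumr -/(m h) [X in _ <= X](_ : _ = m h *
  ((1 - alpha k * zeta) * lyapunov f xs c (X h) (G h) + C)); last by ring.
apply: ler_wpM2l => //.
apply: (@one_step_lyapunov _ _ _ n_gt0 f xs F mu L (alpha k) (eps k) c) => //.
by have := SRG_p x_g_SRG k w; rewrite GE hw; move: hw; rewrite hkE => ->.
Qed.
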